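(* Let $0<d\le n$ and let $q_1,\dots,q_d\in A[x]$ be a $d$-reduced polynomial family with $w$-values $\nu_j=w(q_j(\theta))$. Let $\nu=\max\{\nu_j\mid 1\le j\le d\}$, let $\ell$ be the multiplicity of $\nu$ in the sequence $\nu_1,\dots,\nu_d$, and suppose that the polynomials are ordered so that $\nu_1=\cdots=\nu_\ell=\nu$ and $\nu_{\ell+1},\dots,\nu_d<\nu$. Let $T\in A^{d\times d}$ be the matrix whose rows encode $q_1,\dots,q_d$, and let $T_{\mathrm{up}}$ and $T_{\mathrm{down}}$ be the matrices formed by the first $\ell$ rows and the last $d-\ell$ rows of $T$, respectively. Express the Hermite normal form of $T_{\mathrm{up}}$ as $$\begin{pmatrix} I_m & C\\ 0 & D\end{pmatrix},\qquad C\in A^{m\times(d-m)},\quad D\in A^{(\ell-m)\times(d-m)},$$ with all entries in the first column of $D$ belonging to $\mathfrak{m}$. Write $T_{\mathrm{down}}=(E\mid F)$ with $E\in A^{(d-\ell)\times m}$, $F\in A^{(d-\ell)\times(d-m)}$, and let $$T'=\begin{pmatrix} D\\ F-EC\end{pmatrix}\in A^{(d-m)\times(d-m)}.$$ Let $h_1,\dots,h_{d-m}$ be the polynomials encoded by the rows of $T'$. Then: (1) $\delta_{d-1}=\nu$ and $m(\delta_{d-1})=m$, where $m(\delta_{d-1})$ is the multiplicity of $\delta_{d-1}$ in the family $\delta_0,\dots,\delta_{n-1}$. (2) The monic polynomials $g_{d-1},\dots,g_{d-m}$ encoded by the rows of the matrix $(I_m\mid C)$ have degree $d-1,\dots,d-m$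 and satisfy $w(g_{d-1}(\theta))=\cdots=w(g_{d-m}(\theta))=\delta_{d-1}$. (3) All entries in the matrix $D$ belong to $\mathfrak{m}$. (4) The polynomials $q'_j=h_j\,\pi^{-v(h_j)}$, for $1\le j\le d-m$, form a $(d-m)$-reduced polynomial family whose sequence of $w$-values is $\nu'_j=\nu_{m+j}-v(h_j)$, $1\le j\le d-m$.
   Context: $v\colon K\to\mathbb{Z}\cup\{\infty\}$ is a (normalized) discrete valuation on a field $K$, with valuation ring $A$, uniformizer $\pi\in A$ and maximal ideal $\mathfrak{m}=\pi A$. $L=K(\theta)$ is a finite extension of $K$ of degree $n>1$, where $\theta$ is a root of a monic irreducible polynomial $f\in A[x]$ of degree $n$. The integral closure $B$ of $A$ in $L$ is assumed to be finitely generated as an $A$-module. $w_1,\dots,w_t$ are the valuations on $L$ extending $v$, and $w\colon L\to\mathbb{Q}\cup\{\infty\}$ is defined by $w(\alpha)=\min\{w_i(\alpha)\mid 1\le i\le t\}$. For a polynomial $g=\sum_d a_dx^d\in A[x]$, $v(g)=\min_d v(a_d)$ (Gauss' extension of $v$). A subset (or family) $\{\alpha_1,\dots,\alpha_d\}\subset L^*$ is called reduced if $w\left(\sum_{j=1}^d a_j\alpha_j\right)=\min\{w(a_j\alpha_j)\mid 1\le j\le d\}$ for all $a_1,\dots,a_d\in K$. For $0\le j<n$, $\delta_j=\max\{w(g(\theta))\mid g\in A[x]\text{ monic of degree }j\}$ (the maximum is attained), and $m(\delta_j)$ denotes the multiplicity of $\delta_j$ in the family $\delta_0,\dots,\delta_{n-1}$.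 One has $\delta_0\le\cdots\le\delta_{n-1}$. For $0<d\le n$, a $d$-reduced polynomial family is a family $q_1,\dots,q_d\in A[x]$ such that (i) $\deg(q_j)<d$ and $v(q_j)=0$ for all $1\le j\le d$, and (ii) $q_1(\theta),\dots,q_d(\theta)$ is a reduced family. The $w$-values of the family are the numbers $w(q_j(\theta))$. The rows of a matrix with $s$ columns encode polynomials as follows: a row $(c_{s-1},\dots,c_0)$ encodes $c_{s-1}x^{s-1}+\cdots+c_1x+c_0$ (coefficients in decreasing degree). So the rows of $T$ and of $(I_m\mid C)$ have $d$ entries and encode polynomials of degree $<d$, and the rows of $T'$ have $d-m$ entries and encode polynomials of degree $<d-m$. The Hermite normal form of $T_{\mathrm{up}}$ is the row-style one: the upper echelon matrix $PT_{\mathrm{up}}$, with $P\in\mathrm{GL}_\ell(A)$, whose pivots are powers of $\pi$ and whose entries above each pivot $\pi^e$ are reduced to a fixed set of representatives modulo $\mathfrak{m}^e$ (in particular they are $0$ above a pivot equal to $1$). Blocks with zero rows or columns are allowed.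
   Formalization: In (1), the multiplicity of δ_{d-1} is shown to be m in δ_0,…,δ_{d-1}; in the full family δ_0,…,δ_{n-1} it is shown to be m only if d=n or δ_{d-1}<δ_d, since otherwise the claim fails (e.g. 3-adic Q, f=x²+1, d=1, q_1=1). *)

(* Defs.v *)
From mathcomp Require Import all_boot all_order all_algebra all_field.
From mathcomp Require Import constructive_ereal.

Set Implicit Arguments.
Unset Strict Implicit.
Unset Printing Implicit Defensive.

Import Order.TTheory GRing.Theory Num.Theory.
Local Open Scope ring_scope.
Local Open Scope ereal_scope.

(* Valuations take values in G ∪ {∞}, rendered as [\bar G]; the value [-oo]
   is excluded by the first two axioms. *)
Definition is_valuation (G : realDomainType) (F : fieldType)
    (v : F -> \bar G) : Prop :=
  [/\ v 0%R = +oo,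
      forall x : F, x != 0%R -> v x \is a fin_num,
      forall x y, v (x * y)%R = v x + v y
    & forall x y, mine (v x) (v y) <= v (x + y)%R].

Definition is_discrete_valuation (K : fieldType) (v : K -> \bar int) : Prop :=
  is_valuation v /\ forall k : int, exists x : K, v x = k%:E.

Definition int_rat (x : \bar int) : \bar rat := er_map (fun k => k%:~R : rat) x.

Definition valring (K : fieldType) (v : K -> \bar int) : {pred K} :=
  [pred x | 0 <= v x].

Definition maxideal (K : fieldType) (v : K -> \bar int) : {pred K} :=
  [pred x | 0 < v x].

Definition gauss (K : fieldType) (v : K -> \bar int) (g : {poly K}) : \bar int :=
  \big[mine/+oo]_(i < size g) v g`_i.

Definition extends (K : fieldType) (v : K -> \bar int) (L : fieldExtType K)
    (u : L -> \bar rat) : Prop :=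
  is_valuation u /\ forall a : K, u a%:A = int_rat (v a).

Definition are_the_extensions (K : fieldType) (v : K -> \bar int)
    (L : fieldExtType K) (t : nat) (ws : 'I_t -> L -> \bar rat) : Prop :=
  [/\ forall i, extends v (ws i),
      forall i j, ws i =1 ws j -> i = j
    & forall u : L -> \bar rat, extends v u -> exists i, u =1 ws i].

Definition minval (L : Type) (t : nat) (ws : 'I_t -> L -> \bar rat)
    (alpha : L) : \bar rat :=
  \big[mine/+oo]_(i < t) ws i alpha.

Definition is_integral (K : fieldType) (v : K -> \bar int)
    (L : fieldExtType K) (b : L) : Prop :=
  exists p : {poly K},
    [/\ p \is monic, p \is a polyOver (valring v) & horner_alg b p = 0%R].

Definition integral_closure_fg (K : fieldType) (v : K -> \bar int)
    (L : fieldExtType K) : Prop :=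
  exists (k : nat) (b : 'I_k -> L), forall x : L,
    is_integral v x <->
    exists2 a : 'I_k -> K, (forall i, a i \in valring v)
      & x = (\sum_(i < k) a i *: b i)%R.

Definition reduced (K : fieldType) (L : fieldExtType K) (w : L -> \bar rat)
    (d : nat) (alpha : 'I_d -> L) : Prop :=
  (forall j, alpha j != 0%R) /\
  forall a : 'I_d -> K,
    w (\sum_(j < d) a j *: alpha j)%R =
    \big[mine/+oo]_(j < d) w (a j *: alpha j)%R.

Definition is_delta (K : fieldType) (v : K -> \bar int)
    (L : fieldExtType K) (w : L -> \bar rat) (theta : L) (j : nat)
    (x : \bar rat) : Prop :=
  let S (g : {poly K}) :=
    [/\ g \is a polyOver (valring v), g \is monic & size g = j.+1] in
  (exists2 g, S g & x = w (horner_alg theta g)) /\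
  (forall g, S g -> w (horner_alg theta g) <= x).

(* [gauss v (q j) = 0] forces [q j != 0], so [size (q j) <= d] does mean
   that the degree is < d. *)
Definition reduced_poly_family (K : fieldType) (v : K -> \bar int)
    (L : fieldExtType K) (w : L -> \bar rat) (theta : L) (d : nat)
    (q : 'I_d -> {poly K}) : Prop :=
  (forall j, [/\ q j \is a polyOver (valring v), (size (q j) <= d)%N
               & gauss v (q j) = 0]) /\
  reduced w (fun j => horner_alg theta (q j)).

(* Decreasing degrees: column [j] of [c] carries the coefficient of
   degree [rev_ord j = c - 1 - j]. *)
Definition row_poly (K : fieldType) (k c : nat) (M : 'M[K]_(k, c)) (i : 'I_k) :
    {poly K} :=
  (\sum_(j < c) M i j *: 'X^(rev_ord j))%R.

(* [rep e] is a set of representatives of A modulo the e-th power of the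
   maximal ideal. *)
Definition is_rep_system (K : fieldType) (v : K -> \bar int) (pi : K)
    (rep : nat -> K -> Prop) : Prop :=
  let eqmod e (a b : K) := exists2 c, c \in valring v & (a - b = pi ^+ e * c)%R in
  [/\ forall e a, rep e a -> a \in valring v,
      forall e a, a \in valring v -> exists2 b, rep e b & eqmod e a b,
      forall e b1 b2, rep e b1 -> rep e b2 -> eqmod e b1 b2 -> b1 = b2
    & rep 0%N 0%R].

Definition in_GL (K : fieldType) (A : {pred K}) (k : nat) (P : 'M[K]_k) : Prop :=
  [/\ P \in unitmx, P \is a mxOver A & invmx P \is a mxOver A].

Definition is_pivot (K : fieldType) (k c : nat) (H : 'M[K]_(k, c))
    (i : 'I_k) (j : 'I_c) : Prop :=
  H i j != 0%R /\ forall j' : 'I_c, (j' < j)%N -> H i j' = 0%R.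

Definition is_hermite (K : fieldType) (v : K -> \bar int) (pi : K)
    (rep : nat -> K -> Prop) (k c : nat) (H : 'M[K]_(k, c)) : Prop :=
  [/\ H \is a mxOver (valring v),
      forall (i1 i2 : 'I_k) (j2 : 'I_c), (i1 < i2)%N -> is_pivot H i2 j2 ->
        exists2 j1 : 'I_c, (j1 < j2)%N & is_pivot H i1 j1
    & forall (i : 'I_k) (j : 'I_c), is_pivot H i j ->
        exists2 e : nat, H i j = (pi ^+ e)%R
          & forall i' : 'I_k, (i' < i)%N -> rep e (H i' j)].

Definition hermite_form_of (K : fieldType) (v : K -> \bar int) (pi : K)
    (rep : nat -> K -> Prop) (k c : nat) (M H : 'M[K]_(k, c)) : Prop :=
  is_hermite v pi rep H /\
  exists2 P : 'M[K]_k, in_GL (valring v) P & H = (P *m M)%R.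

(* Main.v *)
Require Import Defs.
From mathcomp Require Import all_boot all_order all_algebra all_field.
From mathcomp Require Import constructive_ereal.
From mathcomp Require Import zify.

Set Implicit Arguments.
Unset Strict Implicit.
Unset Printing Implicit Defensive.

Import Order.TTheory GRing.Theory Num.Theory.
Local Open Scope ring_scope.

(** The proof looks at polynomials of degree < d only through two features of
the K-basis q_1, ..., q_d that it expands them in: since the family of the
q_j(theta) is reduced, [w (p(theta))] is the minimum of the values of the
terms of the expansion, so a lower bound on it is a lower bound on every
coefficient; and the coefficients of p are the corresponding combination of
the rows of the matrix of the family.

The maximal value numax equals delta_(d-1) by two inequalities. If p has
integral coefficients, not all in the maximal ideal, then some coefficient of
its expansion has valuation <= 0, so [w (p(theta)) <= numax]
([reduced_norm_le]). Conversely, such a p of degree <= k has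
[w (p(theta)) <= delta_k] even when it is not monic ([norm_le_delta]): a
leading coefficient in the maximal ideal is removed by subtracting a multiple
of an optimal monic polynomial of the same degree. A member of maximal value
then gives [numax <= delta_(d-1)].

Replacing the rows of T by those of (I C), D and F - E C changes the basis by
a matrix that is block triangular over A for the order of the w-values, and
so is its inverse. Such a change keeps both reducedness and the sequence of
values ([reduced_transfer], applied in [elimination_reduced]). Hence the rows
of T' encode a reduced family with values nu_(m+1), ..., nu_d, which after
division by contents is the family of the q'_j, and the rows of (I C) encode monic
polynomials of value >= numax, so that
[delta_(d-m) = ... = delta_(d-1) = numax].

The multiplicity is no larger. Expand in the family of T' a monic integral
polynomial of degree d-m-1 whose value is >= numax. Its coefficients on the
rows of D are integral, those on the remaining rows lie in the maximal ideal;
as the first column of D lies in the maximal ideal too, the leading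
coefficient 1 would lie there, a contradiction ([monic_norm_lt]). Thus
[delta_(d-m-1) < numax]. Finally, a row of D with a unit entry would encode a
polynomial of degree <= d-m-1 with value numax, against [norm_le_delta]; so D
has all its entries in the maximal ideal. *)

(** * Minima of extended values *)

Lemma bigmin_ge (G : realDomainType) (I : finType) (x : \bar G)
    (F : I -> \bar G) :
  (forall i, x <= F i)%E -> (x <= \big[mine/+oo%E]_i F i)%E.
Proof. by move=> h; apply: le_bigmin => //; rewrite leey. Qed.

Lemma adde_bigmin (G : realDomainType) (I : finType) (x : \bar G)
    (F : I -> \bar G) :
  x \is a fin_num ->
  (x + \big[mine/+oo]_i F i = \big[mine/+oo]_i (x + F i))%E.
Proof.
move=> x_fin; apply: (big_morph (fun y => (x + y)%E)) => [y z|].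
  by rewrite !minEle leeD2lE //; case: ifP.
by case: x x_fin.
Qed.

Lemma ereal_double_eq0 (G : realDomainType) (x : \bar G) :
  x \is a fin_num -> (x + x = 0)%E -> x = 0%E.
Proof.
case: x => // x _ [] /eqP; rewrite -mulr2n mulrn_eq0 /= => /eqP ->.
by [].
Qed.

(** * Valuations *)

Section Valuation.

Variables (G : realDomainType) (F : fieldType) (v : F -> \bar G).
Hypothesis v_val : is_valuation v.

Lemma val0 : v 0 = +oo%E. Proof. by case: v_val. Qed.

Lemma val_fin x : x != 0 -> v x \is a fin_num.
Proof. by case: v_val => _ + _ _; apply. Qed.

Lemma valM x y : v (x * y) = (v x + v y)%E.
Proof. by case: v_val. Qed.

Lemma valD x y : (mine (v x) (v y) <= v (x + y)%R)%E.
Proof. by case: v_val. Qed.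

Lemma val_ltNy x : (-oo < v x)%E.
Proof.
have [->|/val_fin] := eqVneq x 0; first by rewrite val0 ltey.
by case: (v x) => // a _; rewrite ltNyr.
Qed.

Lemma val1 : v 1 = 0%E.
Proof.
have := valM 1 1; rewrite mulr1; have := val_fin (oner_neq0 F).
case: (v 1) => // a _ [] /(congr1 (fun x => x - a)).
by rewrite subrr addrK => <-.
Qed.

Lemma valN x : v (- x) = v x.
Proof.
rewrite -mulN1r valM (_ : v (-1) = 0%E) ?add0e //; apply: ereal_double_eq0.
  by apply: val_fin; rewrite oppr_eq0 oner_eq0.
by rewrite -valM mulrNN mulr1 val1.
Qed.

Lemma val_addr_ge x y z : (x <= v y)%E -> (x <= v z)%E -> (x <= v (y + z)%R)%E.
Proof. by move=> xy xz; apply: le_trans (valD _ _); rewrite le_min xy xz. Qed.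

Lemma val_addr_gt x y z : (x < v y)%E -> (x < v z)%E -> (x < v (y + z)%R)%E.
Proof.
by move=> xy xz; apply: lt_le_trans (valD _ _); rewrite lt_min xy xz.
Qed.

Lemma val_sum_ge (I : Type) (s : seq I) (P : pred I) (f : I -> F) x :
  (forall i, P i -> (x <= v (f i))%E) -> (x <= v (\sum_(i <- s | P i) f i)%R)%E.
Proof.
move=> h; elim/big_ind: _ => //; first by rewrite val0 leey.
exact: val_addr_ge.
Qed.

Lemma val_sum_gt0 (I : Type) (s : seq I) (P : pred I) (f : I -> F) :
  (forall i, P i -> (0 < v (f i))%E) -> (0 < v (\sum_(i <- s | P i) f i)%R)%E.
Proof.
move=> h; elim/big_ind: _ => //; first by rewrite val0 ltey.
exact: val_addr_gt.
Qed.

Lemma valX_ge0 x k : (0 <= v x)%E -> (0 <= v (x ^+ k)%R)%E.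
Proof.
by move=> x0; elim: k => [|k IH]; rewrite ?expr0 ?val1 // exprS valM adde_ge0.
Qed.

Lemma valV x : x != 0 -> v x^-1 = (- v x)%E.
Proof.
move=> x0; have xf := val_fin x0; have := valM x x^-1.
rewrite divff // val1; have := val_fin (invr_neq0 x0).
case: (v x) xf => // a _; case: (v _) => // b _ [] /eqP.
by rewrite eq_sym addr_eq0 => /eqP ->; rewrite /= opprK.
Qed.

End Valuation.

(** * Norms over a valued field *)

Lemma int_ratN x : int_rat (- x)%E = (- int_rat x)%E.
Proof. by case: x => [x||] //=; rewrite intrN. Qed.

Lemma int_rat_ge0 x : (0 <= int_rat x)%E = (0 <= x)%E.
Proof. by case: x => [x||] //=; rewrite !lee_fin ler0z. Qed.

Lemma int_rat_gt0 x : (0 < int_rat x)%E = (0 < x)%E.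
Proof. by case: x => [x||] //=; rewrite !lte_fin ltr0z. Qed.

Lemma int_rat_fin x : (int_rat x \is a fin_num) = (x \is a fin_num).
Proof. by case: x. Qed.

(** The part of the valuation axioms that survives when several valuations
extending v are replaced by their minimum: multiplicativity is kept only for
scalars. *)
Definition is_norm (K : fieldType) (v : K -> \bar int) (V : lmodType K)
    (w : V -> \bar rat) : Prop :=
  [/\ w 0 = +oo%E,
      forall x, x != 0 -> w x \is a fin_num,
      forall a x, w (a *: x) = (int_rat (v a) + w x)%E
    & forall x y, (mine (w x) (w y) <= w (x + y)%R)%E].

Section Norm.

Variables (K : fieldType) (v : K -> \bar int) (V : lmodType K).
Variable w : V -> \bar rat.
Hypotheses (v_val : is_valuation v) (w_norm : is_norm v w).

Lemma norm0 : w 0 = +oo%E. Proof. by case: w_norm. Qed.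

Lemma norm_fin x : x != 0 -> w x \is a fin_num.
Proof. by case: w_norm => _ + _ _; apply. Qed.

Lemma normZ a x : w (a *: x) = (int_rat (v a) + w x)%E.
Proof. by case: w_norm. Qed.

Lemma normD x y : (mine (w x) (w y) <= w (x + y)%R)%E.
Proof. by case: w_norm. Qed.

Lemma norm_sum_ge (I : Type) (s : seq I) (f : I -> V) x :
  (forall i, x <= w (f i))%E -> (x <= w (\sum_(i <- s) f i)%R)%E.
Proof.
move=> h; elim/big_ind: _ => //; first by rewrite norm0 leey.
by move=> y z xy xz; apply: le_trans (normD _ _); rewrite le_min xy xz.
Qed.

Lemma normZ_ge a x : (0 <= v a)%E -> (w x <= w (a *: x))%E.
Proof. by move=> a0; rewrite normZ leeDr // int_rat_ge0. Qed.

Lemma normZ_gt a x : (0 < v a)%E -> x != 0 -> (w x < w (a *: x))%E.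
Proof.
by move=> a0 x0; rewrite normZ lteDr ?norm_fin // int_rat_gt0.
Qed.

Lemma normZ_le a x : (v a <= 0)%E -> (w (a *: x) <= w x)%E.
Proof.
by move=> a0; rewrite normZ geeDr // -oppe_ge0 -int_ratN int_rat_ge0 oppe_ge0.
Qed.

(** With [maxideal_of_norm]: how a bound on one term of an expansion in a
reduced family is turned into information on its coefficient. *)
Lemma valring_of_norm a x y :
  x != 0 -> (w x <= y)%E -> (y <= w (a *: x))%E -> (0 <= v a)%E.
Proof.
move=> x0 xy yax; rewrite leNgt; apply/negP => a0.
have := le_trans xy yax; rewrite leNgt normZ gteDr ?norm_fin //.
by rewrite -oppe_gt0 -int_ratN int_rat_gt0 oppe_gt0 a0.
Qed.

Lemma maxideal_of_norm a x y :
  x != 0 -> (w x < y)%E -> (y <= w (a *: x))%E -> (0 < v a)%E.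
Proof.
move=> x0 xy yax; rewrite ltNge; apply/negP => /normZ_le a0.
by have := lt_le_trans xy (le_trans yax (a0 x)); rewrite ltxx.
Qed.

End Norm.

(** * Reduced families *)

Section Reduced.

Variables (K : fieldType) (v : K -> \bar int) (L : fieldExtType K).
Variable w : L -> \bar rat.
Hypotheses (v_val : is_valuation v) (w_norm : is_norm v w).

Lemma reduced_le (d : nat) (alpha : 'I_d -> L) (a : 'I_d -> K) j :
  reduced w alpha -> (w (\sum_i a i *: alpha i)%R <= w (a j *: alpha j))%E.
Proof. by case=> _ ->; apply: bigmin_le. Qed.

Lemma reduced_of_le (d : nat) (alpha : 'I_d -> L) :
  (forall j, alpha j != 0) ->
  (forall (a : 'I_d -> K) j,
     (w (\sum_i a i *: alpha i)%R <= w (a j *: alpha j))%E) ->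
  reduced w alpha.
Proof.
move=> nz h; split=> // a; apply/le_anti/andP; split; first exact: bigmin_ge.
by apply: (norm_sum_ge w_norm) => i; apply: bigmin_le.
Qed.

Lemma reduced_scale (d : nat) (alpha beta : 'I_d -> L) (c : 'I_d -> K) :
  (forall j, c j != 0) -> (forall j, beta j = c j *: alpha j) ->
  reduced w alpha -> reduced w beta.
Proof.
move=> c0 betaE red; have [nz _] := red; apply: reduced_of_le => [j|a j].
  by rewrite betaE scaler_eq0 negb_or c0 nz.
under eq_bigr do rewrite betaE scalerA.
by rewrite betaE scalerA; apply: (reduced_le (fun i => a i * c i)).
Qed.

Lemma reduced_free (d : nat) (alpha : 'I_d -> L) (a : 'I_d -> K) :
  reduced w alpha -> \sum_i a i *: alpha i = 0 -> forall i, a i = 0.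
Proof.
move=> red a0 i; apply/eqP; have := reduced_le a i red.
rewrite a0 (norm0 w_norm) leye_eq; apply: contraTT => ai0.
have : a i *: alpha i != 0 by rewrite scaler_eq0 negb_or ai0 (proj1 red).
by move=> /(norm_fin w_norm); case: (w _).
Qed.

(** The hypotheses on the entries of Q and R say that each entry costs at most
the difference of the w-values that it relates, in both directions. Those on Q
bound the values of the new family from below. For the opposite inequality, a
combination b of the new family is the combination c = b Q of the old one,
whose terms are bounded by reducedness, and b = c R recovers b. A right inverse
R suffices, so the new family may be smaller than the old one; s tells which
value each new member inherits. *)
Lemma reduced_transfer (d k : nat) (alpha : 'I_d -> L) (beta : 'I_k -> L)
    (s : 'I_k -> 'I_d) (Q : 'M[K]_(k, d)) (R : 'M[K]_(d, k)) :
  reduced w alpha -> Q *m R = 1%:M ->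
  (forall i, beta i = \sum_j Q i j *: alpha j) ->
  (forall i j, (w (alpha (s i)) <= w (Q i j *: alpha j))%E) ->
  (forall j i, (w (alpha j) <= w (R j i *: alpha (s i)))%E) ->
  reduced w beta /\ forall i, w (beta i) = w (alpha (s i)).
Proof.
move=> red QR betaE leQ leR.
have beta_ge i : (w (alpha (s i)) <= w (beta i))%E.
  by rewrite betaE; apply: (norm_sum_ge w_norm).
have beta_le (b : 'I_k -> K) i :
    (w (\sum_i b i *: beta i)%R <= w (b i *: alpha (s i)))%E.
  pose c j := \sum_i b i * Q i j.
  have -> : \sum_i b i *: beta i = \sum_j c j *: alpha j.
    under eq_bigr do rewrite betaE scaler_sumr.
    rewrite exchange_big; apply: eq_bigr => j _.
    by rewrite scaler_suml; apply: eq_bigr => i' _; rewrite scalerA.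
  have -> : b i = \sum_j c j * R j i.
    transitivity (((\row_i b i) *m (Q *m R)) 0 i).
      by rewrite QR mulmx1 mxE.
    rewrite mulmxA mxE; apply: eq_bigr => j _; rewrite mxE; congr (_ * _).
    by apply: eq_bigr => i' _; rewrite mxE.
  rewrite scaler_suml; apply: (norm_sum_ge w_norm) => j.
  apply: le_trans (reduced_le c j red) _.
  by rewrite -scalerA !(normZ w_norm (c j)) leeD2l.
(* [b] a unit vector: [beta_le] bounds a single member. *)
have betaV i : w (beta i) = w (alpha (s i)).
  apply/le_anti; rewrite beta_ge andbT.
  have := beta_le (fun j => (j == i)%:R) i; rewrite (bigD1 i) //= eqxx !scale1r.
  by rewrite big1 ?addr0 // => j /negPf ->; rewrite scale0r.
split=> //; apply: reduced_of_le => [j|b j].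
  apply/eqP => bj; have [nz _] := red; have := norm_fin w_norm (nz (s j)).
  by rewrite -betaV bj (norm0 w_norm).
by apply: le_trans (beta_le b j) _; rewrite !(normZ w_norm) betaV.
Qed.

End Reduced.

(** * The minimum of the extensions of a valuation *)

Lemma polyOver_valringP (K : fieldType) (v : K -> \bar int) (g : {poly K}) :
  is_valuation v ->
  reflect (forall i, (0 <= v g`_i)%E) (g \is a polyOver (valring v)).
Proof.
move=> v_val; apply: (iffP (all_nthP 0)) => h i; last by move=> _; apply: h.
have [/h //|ge] := ltnP i (size g).
by rewrite nth_default // (val0 v_val) leey.
Qed.

Lemma horner_algZ (R : nzSemiRingType) (A : semiAlgType R) (x : A) (c : R)
    (p : {poly R}) : horner_alg x (c *: p) = c *: horner_alg x p.
Proof. by rewrite linearZ /= mulr_algl. Qed.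

Lemma horner_alg_sum (R : nzSemiRingType) (A : semiAlgType R) (x : A)
    (p : {poly R}) : horner_alg x p = \sum_(i < size p) p`_i *: x ^+ i.
Proof.
rewrite -[p in LHS]coefK poly_def raddf_sum; apply: eq_bigr => i _ /=.
by rewrite horner_algZ rmorphXn /= horner_algX.
Qed.

Section MinimumOfExtensions.

Variables (K : fieldType) (v : K -> \bar int) (L : fieldExtType K).
Variables (t : nat) (ws : 'I_t -> L -> \bar rat).
Hypotheses (v_val : is_valuation v) (t_gt0 : (0 < t)%N).
Hypothesis ws_ext : forall i, extends v (ws i).

Let ws_val i : is_valuation (ws i). Proof. by case: (ws_ext i). Qed.

Lemma extendsZ i a x : ws i (a *: x) = (int_rat (v a) + ws i x)%E.
Proof. by rewrite -mulr_algl (valM (ws_val i)); case: (ws_ext i) => _ ->. Qed.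

Lemma minval_le i x : (minval ws x <= ws i x)%E.
Proof. exact: bigmin_le. Qed.

Lemma minval_norm : is_norm v (minval ws).
Proof.
have minval0 : minval ws 0 = +oo%E.
  apply/le_anti; rewrite leey; apply: bigmin_ge => i.
  by rewrite (val0 (ws_val i)).
have minval_fin x : x != 0 -> minval ws x \is a fin_num.
  move=> x0; rewrite /minval.
  have [] := @eq_bigmin _ _ _ +oo%E (Ordinal t_gt0) xpredT (fun i => ws i x).
  - by [].
  - by move=> *; apply: leey.
  by move=> i _ ->; apply: val_fin x0; apply: ws_val.
split=> // [a x|x y].
  have [->|a0] := eqVneq a 0.
    rewrite scale0r minval0 (val0 v_val).
    have [->|/minval_fin] := eqVneq x 0; first by rewrite minval0.
    by case: (minval ws x).
  rewrite /minval; under eq_bigr do rewrite extendsZ.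
  by rewrite -adde_bigmin // int_rat_fin (val_fin v_val).
apply: bigmin_ge => i; apply: (val_addr_ge (ws_val i)).
  by apply: (le_trans _ (minval_le i _)); rewrite ge_min lexx.
by apply: (le_trans _ (minval_le i _)); rewrite ge_min lexx orbT.
Qed.

(** If theta had a negative value, then its inverse would be integral for the
extension; dividing the equation f(theta) = 0 by a power of theta writes theta
as an integral polynomial in its inverse, which has value >= 0. *)
Lemma extends_integral_ge0 i (f : {poly K}) theta :
  f \is monic -> f \is a polyOver (valring v) -> horner_alg theta f = 0 ->
  (0 <= ws i theta)%E.
Proof.
move=> fm fo f0; rewrite leNgt; apply/negP => theta_lt0.
have theta0 : theta != 0.
  by apply: contraTneq theta_lt0 => ->; rewrite (val0 (ws_val i)).
have flead : f`_(size f).-1 = 1 by rewrite -lead_coefE (monicP fm).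
have [k fk] : exists k, size f = k.+2.
  case sf: (size f) => [|[|k]]; last by exists k.
    by have := monic_neq0 fm; rewrite -size_poly_eq0 sf.
  move: f0 flead; rewrite horner_alg_sum sf big_ord1 => + f1.
  by rewrite f1 scale1r => /eqP; rewrite oner_eq0.
have : (0 <= ws i (- \sum_(j < k.+1) f`_j *: theta^-1 ^+ (k - j)))%E.
  rewrite (valN (ws_val i)); apply: (val_sum_ge (ws_val i)) => j _.
  rewrite extendsZ adde_ge0 ?int_rat_ge0 //; first exact/polyOver_valringP.
  apply: (valX_ge0 (ws_val i)).
  by rewrite (valV (ws_val i)) // oppe_ge0 ltW.
suff -> : - \sum_(j < k.+1) f`_j *: theta^-1 ^+ (k - j) = theta 
  by rewrite leNgt theta_lt0.
apply: (mulIf (expf_neq0 k theta0)); rewrite mulNr mulr_suml.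
have := f0; rewrite horner_alg_sum fk big_ord_recr /=.
move: flead; rewrite fk /= => ->; rewrite scale1r -exprS => /eqP.
rewrite addrC addr_eq0 => /eqP ->; congr (- _); apply: eq_bigr => j _.
rewrite -scalerAl; congr (_ *: _); rewrite exprVn mulrC.
by rewrite -[in X in X / _](subnK (leq_ord j)) addnC exprD mulfK ?expf_neq0.
Qed.

Lemma minval_integral_mul_ge (f : {poly K}) theta x :
  f \is monic -> f \is a polyOver (valring v) -> horner_alg theta f = 0 ->
  (minval ws x <= minval ws (theta * x)%R)%E.
Proof.
move=> fm fo f0; apply: bigmin_ge => i; rewrite (valM (ws_val i)).
apply: le_trans (minval_le i _) _; rewrite leeDr //.
exact: extends_integral_ge0 fm fo f0.
Qed.

End MinimumOfExtensions.

(** * Gauss' extension of the valuation *)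

Section Gauss.

Variables (K : fieldType) (v : K -> \bar int).
Hypothesis v_val : is_valuation v.

Lemma gauss_le (g : {poly K}) i : (gauss v g <= v g`_i)%E.
Proof.
have [lt|ge] := ltnP i (size g); last first.
  by rewrite nth_default // (val0 v_val) leey.
exact: (@bigmin_inf _ _ _ _ (Ordinal lt)).
Qed.

Lemma gauss_attained (g : {poly K}) :
  g != 0 -> exists i : 'I_(size g), gauss v g = v g`_i.
Proof.
rewrite -size_poly_gt0 => g0.
have [|i _|i _ eqi] := @eq_bigmin _ _ _ +oo%E (Ordinal g0) xpredT
  (fun i : 'I__ => v g`_i); [by []|by apply: leey|by exists i].
Qed.

Lemma gaussZ c (g : {poly K}) :
  c != 0 -> gauss v (c *: g) = (v c + gauss v g)%E.
Proof.
move=> c0; rewrite /gauss adde_bigmin ?(val_fin v_val) // size_scale //.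
by apply: eq_bigr => i _; rewrite coefZ (valM v_val).
Qed.

Lemma gauss_fin (g : {poly K}) : g != 0 -> gauss v g \is a fin_num.
Proof.
move=> g0; have [i gi] := gauss_attained g0; rewrite fin_real // gi val_ltNy //.
have gl0 : lead_coef g != 0 by rewrite lead_coef_eq0.
have := gauss_le g (size g).-1; rewrite gi -lead_coefE => /le_lt_trans; apply.
by have := val_fin v_val gl0; case: (v _) => // x _; rewrite ltry.
Qed.

Lemma gauss_eq0_nonmax (g : {poly K}) :
  gauss v g = 0%E -> exists i, (v g`_i <= 0)%E.
Proof.
have [->|/gauss_attained [i ->] gi0] := eqVneq g 0; last first.
  by exists i; rewrite gi0.
by rewrite /gauss size_poly0 big_ord0.
Qed.

End Gauss.

Lemma discrete_val_expz (K : fieldType) (v : K -> \bar int) (pi : K) (k : int) :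
  is_valuation v -> v pi = 1%:E%E -> v (pi ^ k) = k%:E%E.
Proof.
move=> v_val v_pi.
have vX j : v (pi ^+ j) = (j%:Z)%:E%E.
  elim: j => [|j IH]; first by rewrite expr0 (val1 v_val).
  by rewrite exprS (valM v_val) IH v_pi -EFinD intS.
have pi0 : pi != 0.
  by apply/eqP => p0; move: v_pi; rewrite p0 (val0 v_val).
case: k => j; first exact: vX.
by rewrite [pi ^ _]/(pi ^- j.+1) (valV v_val) ?expf_neq0 // vX NegzE.
Qed.

(** * Polynomials encoded by the rows of a matrix *)

Section RowPoly.

Variable K : fieldType.

Lemma coef_row_poly (k c : nat) (M : 'M[K]_(k, c)) i (j : 'I_c) :
  (row_poly M i)`_(rev_ord j) = M i j.
Proof.
rewrite coef_sum (bigD1 j) //= coefZ coefXn eqxx mulr1 big1 ?addr0 // => j' neq.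
rewrite coefZ coefXn [_ == _](_ : _ = false) ?mulr0 //.
apply/negP => /eqP e; move: neq; rewrite -(inj_eq rev_ord_inj).
by rewrite -val_eqE /= e eqxx.
Qed.

Lemma size_row_poly (k c : nat) (M : 'M[K]_(k, c)) i :
  (size (row_poly M i) <= c)%N.
Proof.
apply: (leq_trans (size_sum _ _ _)); apply/bigmax_leqP => j _.
by apply: leq_trans (size_scale_leq _ _) _; rewrite size_polyXn.
Qed.

Lemma row_poly_mulmx (k1 k2 c : nat) (A : 'M[K]_(k1, k2))
    (M : 'M[K]_(k2, c)) i :
  row_poly (A *m M) i = \sum_j A i j *: row_poly M j.
Proof.
rewrite /row_poly; under eq_bigr do rewrite mxE scaler_suml.
under [RHS]eq_bigr do rewrite scaler_sumr.
by rewrite exchange_big; do 2!(apply: eq_bigr => ? _); rewrite scalerA.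
Qed.

Lemma row_poly_row_mx0 (k c1 c2 : nat) (M : 'M[K]_(k, c2)) i :
  row_poly (row_mx (0 : 'M_(k, c1)) M) i = row_poly M i.
Proof.
rewrite /row_poly big_split_ord /= big1 ?add0r => [|j _].
  apply: eq_bigr => j _; rewrite row_mxEr; congr (_ *: 'X^_).
  by rewrite /= -addnS subnDl.
by rewrite row_mxEl mxE scale0r.
Qed.

Lemma row_poly_surj (c : nat) (p : {poly K}) :
  (size p <= c)%N -> exists u : 'rV[K]_c, p = row_poly u 0.
Proof.
move=> sp; exists (\row_j p`_(rev_ord j)); apply/polyP => i.
have [lt|ge] := ltnP i c.
  rewrite -[i]/(val (Ordinal lt)) -[Ordinal lt]rev_ordK.
  by rewrite coef_row_poly mxE rev_ordK.
by rewrite !nth_default // (leq_trans _ ge) // size_row_poly.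
Qed.

Lemma row_poly_expand (k c : nat) (M : 'M[K]_(k, c)) (p : {poly K}) :
  row_full M -> (size p <= c)%N ->
  exists a : 'I_k -> K, p = \sum_j a j *: row_poly M j.
Proof.
move=> fullM /row_poly_surj [u ->].
have /submxP [A ->] := submx_full u fullM.
by exists (A 0); rewrite row_poly_mulmx.
Qed.

Lemma row_poly_usubmx (k1 k2 c : nat) (M : 'M[K]_(k1 + k2, c)) i :
  row_poly (usubmx M) i = row_poly M (lshift k2 i).
Proof. by apply: eq_bigr => j _; rewrite mxE. Qed.

(** Row i of (I C) starts with i zeros followed by a 1, so that it encodes a
monic polynomial of degree m + c - 1 - i. *)
Lemma monic_row_poly_row_mx1 (m c : nat) (C : 'M[K]_(m, c)) i :
  row_poly (row_mx 1%:M C) i \is monic /\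
  size (row_poly (row_mx 1%:M C) i) = (m + c - i)%N.
Proof.
set p := row_poly _ _.
have lt_mc : (i < m + c)%N by apply: ltn_addr.
have p1 : p`_(m + c - i.+1) = 1.
  rewrite -[(_ - _)%N]/(val (rev_ord (lshift c i))) coef_row_poly.
  by rewrite row_mxEl mxE eqxx.
have ps : size p = (m + c - i)%N.
  apply/eqP; rewrite eqn_leq; apply/andP; split; last first.
    rewrite -subSS subSn // ltnNge; apply/negP => ge; move/eqP: p1.
    by rewrite nth_default // eq_sym oner_eq0.
  apply/leq_sizeP => k ki; have [ltk|gek] := ltnP k (m + c); last first.
    by rewrite nth_default // (leq_trans (size_row_poly _ _)).
  have jm : (m + c - k.+1 < i)%N by lia.
  have -> : k = rev_ord (lshift c (Ordinal (ltn_trans jm (ltn_ord i)))).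
    by rewrite /=; lia.
  rewrite coef_row_poly row_mxEl mxE -val_eqE /= gtn_eqF //.
split=> //; rewrite monicE lead_coefE ps -subnS p1 //.
Qed.

(** A linear relation between the rows evaluates at theta to a relation in L,
and the members of a reduced family are linearly independent. *)
Lemma reduced_row_free (v : K -> \bar int) (L : fieldExtType K)
    (w : L -> \bar rat) (theta : L) (k c : nat) (M : 'M[K]_(k, c))
    (q : 'I_k -> {poly K}) :
  is_norm v w -> (forall j, row_poly M j = q j) ->
  reduced w (fun j => horner_alg theta (q j)) -> row_free M.
Proof.
move=> w_norm Mq red; rewrite -kermx_eq0; apply/rowV0P => u /sub_kermxP uM.
apply/rowP => j; rewrite mxE.
apply: (reduced_free w_norm (a := u 0) red).
under eq_bigr do rewrite -Mq -horner_algZ.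
rewrite -raddf_sum -row_poly_mulmx uM /row_poly big1 ?raddf0 // => i _.
by rewrite mxE scale0r.
Qed.

End RowPoly.

(** * Integral matrices *)

Section IntegralMatrix.

Variables (K : fieldType) (v : K -> \bar int).
Hypothesis v_val : is_valuation v.

Lemma mxOver_valringP (k c : nat) (M : 'M[K]_(k, c)) :
  reflect (forall i j, (0 <= v (M i j))%E) (M \is a mxOver (valring v)).
Proof. exact: mxOverP. Qed.

Lemma mxOver_valringM (k1 k2 k3 : nat) (A : 'M[K]_(k1, k2))
    (B : 'M[K]_(k2, k3)) :
  A \is a mxOver (valring v) -> B \is a mxOver (valring v) ->
  A *m B \is a mxOver (valring v).
Proof.
move=> /mxOver_valringP Av /mxOver_valringP Bv; apply/mxOver_valringP => i j.
by rewrite mxE; apply: (val_sum_ge v_val) => k _; rewrite (valM v_val) adde_ge0.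
Qed.

Lemma mxOver_valringB (k c : nat) (A B : 'M[K]_(k, c)) :
  A \is a mxOver (valring v) -> B \is a mxOver (valring v) ->
  A - B \is a mxOver (valring v).
Proof.
move=> /mxOver_valringP Av /mxOver_valringP Bv; apply/mxOver_valringP => i j.
by rewrite !mxE; apply: (val_addr_ge v_val); rewrite // (valN v_val).
Qed.

Lemma mxOver_valring_row_poly (k c : nat) (M : 'M[K]_(k, c)) :
  (forall i, row_poly M i \is a polyOver (valring v)) <->
  M \is a mxOver (valring v).
Proof.
split=> [Mv|/mxOver_valringP Mv i].
  apply/mxOver_valringP => i j; rewrite -coef_row_poly.
  exact/(polyOver_valringP _ v_val).
apply/(polyOver_valringP _ v_val) => k'; have [lt|ge] := ltnP k' c.
  by rewrite -[k']/(val (Ordinal lt)) -[Ordinal lt]rev_ordK coef_row_poly.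
by rewrite nth_default ?(val0 v_val) ?leey // (leq_trans (size_row_poly _ _)).
Qed.

End IntegralMatrix.

(** * The numbers delta *)

Section Delta.

Variables (K : fieldType) (v : K -> \bar int) (L : fieldExtType K).
Variables (w : L -> \bar rat) (theta : L) (n : nat) (delta : nat -> \bar rat).
Hypotheses (v_val : is_valuation v) (w_norm : is_norm v w).
Hypothesis w_theta : forall x, (w x <= w (theta * x)%R)%E.
Hypothesis delta_max : forall j, (j < n)%N -> is_delta v w theta j (delta j).

(** Multiplying an optimal monic polynomial by X raises its degree by one and
does not lower its value, theta being integral. *)
Lemma delta_mono i j : (i <= j < n)%N -> (delta i <= delta j)%E.
Proof.
elim: j => [|j IH]; first by rewrite leqn0 => /andP [/eqP ->].
case/andP; rewrite leq_eqVlt => /predU1P [-> //|ij jn].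
apply: le_trans (IH _) _; first by rewrite -ltnS ij ltnW.
have [[g [go gm gs] ->] _] := delta_max (ltnW jn).
apply: le_trans (w_theta _) _.
have [_ h] := delta_max jn.
rewrite -[X in X * _](horner_algX theta) -rmorphM /=.
apply: h; split; last by rewrite mulrC size_mulX ?monic_neq0 // gs.
  apply/(polyOver_valringP _ v_val) => i'; rewrite coefXM.
  case: eqP => _; first by rewrite (val0 v_val) leey.
  exact/(polyOver_valringP _ v_val).
by rewrite monicMl ?monicX.
Qed.

Lemma norm_le_delta_unit k (g : {poly K}) :
  (k < n)%N -> g \is a polyOver (valring v) -> (v g`_k <= 0)%E ->
  (size g <= k.+1)%N -> (w (horner_alg theta g) <= delta k)%E.
Proof.
move=> kn /(polyOver_valringP _ v_val) go gk sg; set a := g`_k in gk.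
have a0 : a != 0 by apply: contraTneq gk => ->; rewrite (val0 v_val).
have sgE : size g = k.+1.
  apply/eqP; rewrite eqn_leq sg ltnNge.
  by apply: contraNN a0 => ge; rewrite /a nth_default.
have -> : g = a *: (a^-1 *: g) by rewrite scalerA divff // scale1r.
rewrite horner_algZ; apply: le_trans (normZ_le w_norm _ gk) _.
have [_ ub] := delta_max kn; apply: ub; split.
- apply/(polyOver_valringP _ v_val) => i; rewrite coefZ (valM v_val) adde_ge0 //.
  by rewrite (valV v_val) // oppe_ge0.
- by rewrite monicE lead_coefZ lead_coefE sgE mulVf.
- by rewrite size_scale ?invr_eq0.
Qed.

(** The bound by delta_k holds for all integral polynomials of degree <= k with
a coefficient outside the maximal ideal. If the coefficient of degree k lies in
the maximal ideal, cancel it with a multiple of a monic p attaining delta_k.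
That multiple has value > delta_k (an infinite delta_k leaves nothing to
prove), and the remainder has smaller degree and is
congruent to g, so by induction its value is at most
[delta_(k-1) <= delta_k]. Hence the value of g cannot exceed delta_k. *)
Lemma norm_le_delta k (g : {poly K}) i :
  (k < n)%N -> g \is a polyOver (valring v) -> (v g`_i <= 0)%E ->
  (size g <= k.+1)%N -> (w (horner_alg theta g) <= delta k)%E.
Proof.
elim: k g => [|k IH] g kn go gi sg.
  apply: norm_le_delta_unit => //; case: i gi => // i.
  by rewrite nth_default ?(val0 v_val) // (leq_trans sg).
have [gk|gk] := leP (v g`_k.+1) 0%E; first exact: norm_le_delta_unit.
have [[p [po pm ps] delE] _] := delta_max kn.
rewrite leNgt; apply/negP => lt_del.
pose a := - g`_k.+1; pose g' := g + a *: p.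
have a_gt0 : (0 < v a)%E by rewrite (valN v_val).
have ap_gt0 j : (0 < v (a *: p)`_j)%E.
  rewrite coefZ (valM v_val); apply: lt_le_trans a_gt0 _.
  by rewrite leeDl //; apply/polyOver_valringP.
have : (w (horner_alg theta g') <= delta k)%E.
  apply: IH => //; first exact: ltnW.
  - apply/(polyOver_valringP _ v_val) => j; rewrite coefD.
    apply: (val_addr_ge v_val); last exact: ltW.
    exact/polyOver_valringP.
  - rewrite leNgt; apply/negP => g'i; move: gi; rewrite leNgt => /negP; apply.
    rewrite -(addrK (a *: p) g) coefB.
    by apply: (val_addr_gt v_val); rewrite // (valN v_val).
  apply/leq_sizeP => j; rewrite leq_eqVlt coefD coefZ => /predU1P [<-|kj].
    by rewrite (_ : p`_k.+1 = 1) ?mulr1 ?subrr // -(monicP pm) lead_coefE ps.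
  by rewrite !nth_default ?mulr0 ?addr0 // ?ps // (leq_trans sg).
apply/negP; rewrite -ltNge; apply: le_lt_trans (delta_mono (j := k.+1) _) _.
  by rewrite leqnSn.
rewrite rmorphD /= horner_algZ; apply: lt_le_trans (normD w_norm _ _).
rewrite lt_min lt_del delE (normZ_gt w_norm) //.
apply: contraTneq lt_del => p0.
by rewrite delE p0 (norm0 w_norm) -leNgt leey.
Qed.

End Delta.

(** * Polynomials expanded in a reduced family *)

Section Expansion.

Variables (K : fieldType) (v : K -> \bar int) (L : fieldExtType K).
Variables (w : L -> \bar rat) (theta : L).
Hypotheses (v_val : is_valuation v) (w_norm : is_norm v w).

(** If all coefficients of the expansion of p in the family were in the maximal
ideal, so would be all coefficients of p; and one term with a coefficient of
valuation <= 0 bounds the value of p. *)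
Lemma reduced_norm_le (k c : nat) (M : 'M[K]_(k, c)) (q : 'I_k -> {poly K})
    (x : \bar rat) (p : {poly K}) i :
  (forall j, row_poly M j = q j) ->
  (forall j, q j \is a polyOver (valring v)) ->
  reduced w (fun j => horner_alg theta (q j)) -> row_full M ->
  (forall j, (w (horner_alg theta (q j)) <= x)%E) ->
  (size p <= c)%N -> (v p`_i <= 0)%E -> (w (horner_alg theta p) <= x)%E.
Proof.
move=> Mq qv red fullM qx /(row_poly_expand fullM) [a pE] pi_le0.
have [/existsP [j aj]|] := boolP [exists j, (v (a j) <= 0)%E].
  apply: le_trans (le_trans (normZ_le w_norm _ aj) (qx j)).
  rewrite pE raddf_sum /=; under eq_bigr do rewrite Mq horner_algZ.
  exact: (reduced_le a j red).
rewrite negb_exists => /forallP a_gt0; move: pi_le0; rewrite leNgt => /negP [].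
rewrite pE coef_sum; apply: (val_sum_gt0 v_val) => j _.
rewrite coefZ (valM v_val) Mq.
have aj : (0 < v (a j))%E by rewrite ltNge.
apply: lt_le_trans aj _; rewrite leeDl //.
by apply/(polyOver_valringP _ v_val).
Qed.

(** Column [j0] is that of the leading coefficients. If p had value >= x, its
expansion would have integral coefficients on the rows of value <= x and
coefficients in the maximal ideal on those of value < x; either way each row
contributes an element of the maximal ideal to the leading coefficient 1. *)
Lemma monic_norm_lt (c : nat) (M : 'M[K]_c) (j0 : 'I_c) (x : \bar rat)
    (p : {poly K}) :
  j0 = 0%N :> nat ->
  reduced w (fun j => horner_alg theta (row_poly M j)) ->
  (forall j,
     (w (horner_alg theta (row_poly M j)) <= x /\ 0 < v (M j j0))%E \/
     (w (horner_alg theta (row_poly M j)) < x /\ 0 <= v (M j j0))%E) ->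
  p \is monic -> size p = c -> (w (horner_alg theta p) < x)%E.
Proof.
move=> j00 red hM pm sp; rewrite ltNge; apply/negP => x_le.
have fullM : row_full M.
  rewrite row_full_unit -row_free_unit.
  exact: reduced_row_free w_norm (fun=> erefl) red.
have [a pE] := row_poly_expand fullM (eq_leq sp).
have x_le_a j : (x <= w (a j *: horner_alg theta (row_poly M j)))%E.
  apply: le_trans x_le _; rewrite pE raddf_sum /=.
  under eq_bigr do rewrite horner_algZ.
  exact: (reduced_le a j red).
have : (0 < v p`_(rev_ord j0))%E.
  rewrite pE coef_sum; apply: (val_sum_gt0 v_val) => j _.
  rewrite coefZ coef_row_poly (valM v_val); have [nz _] := red.
  case: (hM j) => -[hx hv].
    have := valring_of_norm w_norm (nz j) hx (x_le_a j) => av.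
    by apply: lt_le_trans hv _; rewrite leeDr.
  have := maxideal_of_norm w_norm (nz j) hx (x_le_a j) => av.
  by apply: lt_le_trans av _; rewrite leeDl.
have -> : p`_(rev_ord j0) = 1.
  by rewrite -(monicP pm) lead_coefE sp /= j00 subn1.
by rewrite (val1 v_val) ltxx.
Qed.

End Expansion.

(** * Eliminating the monic rows *)

Section Elimination.

Variables (K : fieldType) (v : K -> \bar int) (L : fieldExtType K).
Variables (w : L -> \bar rat) (theta : L).
Hypotheses (v_val : is_valuation v) (w_norm : is_norm v w).
Variables (m r s : nat) (q : 'I_(m + r + s) -> {poly K}).
Variables (T : 'M[K]_(m + r + s, m + (r + s))).
Variables (C : 'M[K]_(m, r + s)) (D : 'M[K]_(r, r + s)) (P : 'M[K]_(m + r)).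
Variable x : \bar rat.
Hypothesis Tq : forall j, row_poly T j = q j.
Hypothesis q_int : forall j, q j \is a polyOver (valring v).
Hypothesis q_red : reduced w (fun j => horner_alg theta (q j)).
Hypothesis q_le : forall j, (w (horner_alg theta (q j)) <= x)%E.
Hypothesis q_top : forall j : 'I_(m + r + s), (j < m + r)%N ->
  w (horner_alg theta (q j)) = x.
Hypothesis P_GL : in_GL (valring v) P.
Hypothesis PT : block_mx 1%:M C 0 D = P *m usubmx T.

Local Notation E := (lsubmx (dsubmx T)).
Local Notation F := (rsubmx (dsubmx T)).
Local Notation T' := (col_mx D (F - E *m C)).
Local Notation sigma :=
  (fun j : 'I_(r + s) => cast_ord (addnA m r s) (rshift m j)).
(* Q T = (0 T'): P performs the reduction to Hermite form, of which only the
   rows of D are kept, and - E times its first rows clears the first block of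
   the lower part. R is a right inverse of Q, and the lower left block of R is 0
   because the rows of [usubmx P] are orthogonal to the columns of
   [rsubmx (invmx P)]. *)
Let Q : 'M[K]_(r + s, m + r + s) :=
  block_mx (dsubmx P) 0 (- E *m usubmx P) 1%:M.
Let R : 'M[K]_(m + r + s, r + s) := block_mx (rsubmx (invmx P)) 0 0 1%:M.

Lemma T_int : T \is a mxOver (valring v).
Proof. by apply/(mxOver_valring_row_poly v_val) => i; rewrite Tq. Qed.

Let Tup_int : usubmx T \is a mxOver (valring v).
Proof.
by apply/mxOver_valringP => i j; rewrite mxE; apply/mxOver_valringP/T_int.
Qed.

Let E_int : E \is a mxOver (valring v).
Proof.
by apply/mxOver_valringP => i j; rewrite !mxE; apply/mxOver_valringP/T_int.
Qed.

Lemma row_mx1C : row_mx 1%:M C = usubmx P *m usubmx T.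
Proof. by rewrite mul_usub_mx -PT block_mxEv col_mxKu. Qed.

Lemma row_mx0D : row_mx 0 D = dsubmx P *m usubmx T.
Proof. by rewrite mul_dsub_mx -PT block_mxEv col_mxKd. Qed.

Lemma row_mx1C_int : row_mx 1%:M C \is a mxOver (valring v).
Proof.
have [_ P_int _] := P_GL.
rewrite row_mx1C; apply: (mxOver_valringM v_val) => //.
by apply/mxOver_valringP => i j; rewrite mxE; apply/mxOver_valringP.
Qed.

Lemma C_int : C \is a mxOver (valring v).
Proof.
have /mxOver_valringP h := row_mx1C_int; apply/mxOver_valringP => i j.
by rewrite -(row_mxEr 1%:M C).
Qed.

Lemma D_int : D \is a mxOver (valring v).
Proof.
have [_ P_int _] := P_GL.
have : row_mx (0 : 'M_(r, m)) D \is a mxOver (valring v).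
  rewrite row_mx0D; apply: (mxOver_valringM v_val) => //.
  by apply/mxOver_valringP => i j; rewrite mxE; apply/mxOver_valringP.
move/mxOver_valringP => h; apply/mxOver_valringP => i j.
by rewrite -(row_mxEr (0 : 'M_(r, m)) D).
Qed.

Lemma T'_int : T' \is a mxOver (valring v).
Proof.
have FEC : F - E *m C \is a mxOver (valring v).
  apply: (mxOver_valringB v_val).
    by apply/mxOver_valringP => i j; rewrite !mxE; apply/mxOver_valringP/T_int.
  by apply: (mxOver_valringM v_val) => //; apply: C_int.
apply/mxOver_valringP => i j; case: (split_ordP i) => {}i ->.
  by rewrite col_mxEu; apply/mxOver_valringP/D_int.
by rewrite col_mxEd; apply/mxOver_valringP.
Qed.

Lemma elimination_mul : row_mx 0 T' = Q *m T.
Proof.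
transitivity (Q *m col_mx (usubmx T) (row_mx E F)); last first.
  by rewrite hsubmxK vsubmxK.
rewrite mul_block_col -row_mx0D mul0mx addr0 mul1mx.
rewrite -mulmxA -row_mx1C mul_mx_row mulmx1.
rewrite add_row_mx mulNmx addNr addrC.
by rewrite -block_mxEv block_mxEh col_mx0.
Qed.

Lemma elimination_inv : Q *m R = 1%:M.
Proof.
have [Punit _ _] := P_GL.
have := mulmxV Punit.
rewrite -[P in P *m _]vsubmxK -[invmx P]hsubmxK mul_col_row scalar_mx_block.
case/eq_block_mx => _ PuR _ PdR.
by rewrite mulmx_block !mulmx0 !mul0mx mulmx1 addr0 add0r -mulmxA PuR mulmx0
   PdR !addr0 add0r -scalar_mx_block.
Qed.

(** Entries of Q and R are integral and vanish where they would express one of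
the m + r members of maximal value through one of the others, while on the
others both matrices act as the identity: this is the balance of values required
by [reduced_transfer]. *)
Lemma elimination_reduced :
  reduced w (fun j => horner_alg theta (row_poly T' j)) /\
  forall j, w (horner_alg theta (row_poly T' j)) =
            w (horner_alg theta (q (cast_ord (addnA m r s) (rshift m j)))).
Proof.
have [_ P_int Pinv_int] := P_GL.
have sigma_top j : w (horner_alg theta (q (sigma (lshift s j)))) = x.
  by rewrite q_top //= ltn_add2l.
have top j : w (horner_alg theta (q (lshift s j))) = x by rewrite q_top /=.
have sigma_r j : sigma (rshift r j) = rshift (m + r) j.
  by apply: ord_inj; rewrite /= addnA.
apply: (reduced_transfer w_norm q_red elimination_inv).
- move=> i; under eq_bigr do rewrite -horner_algZ -Tq.
  by rewrite -raddf_sum -row_poly_mulmx -elimination_mul row_poly_row_mx0.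
- have EP_int : - E *m usubmx P \is a mxOver (valring v).
    apply: (mxOver_valringM v_val).
      apply/mxOver_valringP => i j; rewrite mxE (valN v_val).
      exact/mxOver_valringP.
    by apply/mxOver_valringP => i j; rewrite mxE; apply/mxOver_valringP.
  move=> i j; case: (split_ordP i) => {}i ->; case: (split_ordP j) => {}j ->.
  + rewrite block_mxEul sigma_top -(top j); apply: (normZ_ge w_norm).
    by rewrite mxE; apply/mxOver_valringP.
  + by rewrite block_mxEur mxE scale0r (norm0 w_norm) leey.
  + rewrite block_mxEdl; apply: le_trans (q_le _) _; rewrite -(top j).
    by apply: (normZ_ge w_norm); apply/mxOver_valringP.
  rewrite block_mxEdr mxE sigma_r; case: eqP => [->|_].
    by rewrite scale1r.
  by rewrite scale0r (norm0 w_norm) leey.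
move=> j i; case: (split_ordP i) => {}i ->; case: (split_ordP j) => {}j ->.
- rewrite block_mxEul (top j) -(sigma_top i); apply: (normZ_ge w_norm).
  by rewrite mxE; apply/mxOver_valringP.
- by rewrite block_mxEdl mxE scale0r (norm0 w_norm) leey.
- by rewrite block_mxEur mxE scale0r (norm0 w_norm) leey.
rewrite block_mxEdr mxE sigma_r; case: eqP => [->|_].
  by rewrite scale1r.
by rewrite scale0r (norm0 w_norm) leey.
Qed.

Lemma norm_row_mx1C_ge i :
  (x <= w (horner_alg theta (row_poly (row_mx 1%:M C) i)))%E.
Proof.
have [_ /mxOver_valringP P_int _] := P_GL.
rewrite row_mx1C row_poly_mulmx raddf_sum /=.
apply: (norm_sum_ge w_norm) => j; rewrite horner_algZ row_poly_usubmx Tq.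
have <- : w (horner_alg theta (q (lshift s j))) = x by apply: q_top => /=.
by apply: (normZ_ge w_norm); rewrite mxE.
Qed.

End Elimination.

(** * The multiplicity of the largest value *)

Lemma count_mem_mkseq_block (A : eqType) (f : nat -> A) (y : A) (a b n : nat) :
  (a + b <= n)%N ->
  (forall k, (k < n)%N -> (f k == y) = (a <= k < a + b)%N) ->
  count_mem y (mkseq f n) = b.
Proof.
move=> abn h; rewrite count_map.
rewrite (@eq_in_count _ _ (fun k => (a <= k < a + b)%N)); last first.
  by move=> k; rewrite mem_iota => /andP [_ kn] /=; rewrite h.
rewrite -(subnKC abn) -addnA iotaD count_cat iotaD count_cat add0n.
rewrite (@eq_in_count _ _ pred0) ?count_pred0; last first.
  by move=> k; rewrite mem_iota /=; lia.
rewrite (@eq_in_count _ _ predT (iota a b)); last first.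
  by move=> k; rewrite mem_iota /=; lia.
rewrite (@eq_in_count _ _ pred0 (iota (a + b) _)) ?count_pred0; last first.
  by move=> k; rewrite mem_iota /=; lia.
by rewrite count_predT size_iota addn0.
Qed.

(* The family has d = m + r + s members, l = m + r of them of maximal w-value;
   families are indexed from 0. *)
Theorem proposition3p8
  (K : fieldType) (v : K -> \bar int) (v_discr : is_discrete_valuation v)
  (pi : K) (v_pi : v pi = 1%:E)
  (L : fieldExtType K) (theta : L) (f : {poly K}) (n : nat)
  (n_gt1 : (1 < n)%N)
  (f_monic : f \is monic) (f_int : f \is a polyOver (valring v))
  (f_irr : irreducible_poly f) (f_deg : size f = n.+1)
  (f_theta : horner_alg theta f = 0) (L_gen : <<1; theta>>%VS = fullv)
  (B_fg : integral_closure_fg v L)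
  (t : nat) (ws : 'I_t -> L -> \bar rat) (t_gt0 : (0 < t)%N)
  (ws_ext : are_the_extensions v ws)
  (delta : nat -> \bar rat)
  (delta_max : forall j, (j < n)%N -> is_delta v (minval ws) theta j (delta j))
  (rep : nat -> K -> Prop) (rep_sys : is_rep_system v pi rep)
  (m r s : nat) (q : 'I_(m + r + s) -> {poly K})
  (T : 'M[K]_(m + r + s, m + (r + s)))
  (C : 'M[K]_(m, r + s)) (D : 'M[K]_(r, r + s)) :
  let w := minval ws in
  let d := (m + r + s)%N in
  let l := (m + r)%N in
  let nu j := w (horner_alg theta (q j)) in
  let numax := (\big[maxe/-oo]_(j < d) nu j)%E in
  let Tup := usubmx T in
  let E := lsubmx (dsubmx T) in
  let F := rsubmx (dsubmx T) in
  let T' := col_mx D (F - E *m C) in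
  let g := row_poly (row_mx 1%:M C) in
  let h := row_poly T' in
  let q' j := pi ^ (- fine (gauss v (h j))) *: h j in
  (0 < d <= n)%N ->
  reduced_poly_family v w theta q ->
  (forall j : 'I_d, (j < l)%N -> nu j = numax) ->
  (forall j : 'I_d, (l <= j)%N -> (nu j < numax)%E) ->
  (forall j, row_poly T j = q j) ->
  hermite_form_of v pi rep Tup (block_mx 1%:M C 0 D) ->
  (forall (i : 'I_r) (j : 'I_(r + s)), j = 0%N :> nat -> D i j \in maxideal v) ->
  [/\ [/\ delta d.-1 = numax,
          count_mem (delta d.-1) (mkseq delta d) = m
        & ((d < n)%N -> (delta d.-1 < delta d)%E) ->
          count_mem (delta d.-1) (mkseq delta n) = m],
      forall i : 'I_m,
        [/\ g i \is monic, size (g i) = (d - i)%N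
          & w (horner_alg theta (g i)) = delta d.-1],
      D \is a mxOver (maxideal v)
    & reduced_poly_family v w theta q' /\
      forall j : 'I_(r + s),
        w (horner_alg theta (q' j)) =
        (nu (cast_ord (addnA m r s) (rshift m j))
           - int_rat (gauss v (h j)))%E].
Proof.
move=> w d l nu numax Tup E F T' g h q' /andP [d_gt0 dn] [q_poly q_red].
move=> nu_top nu_low Tq [_ [P P_GL PT]] D0.
have [v_val _] := v_discr.
have [ws_val _ _] := ws_ext.
have w_norm : is_norm v w by apply: minval_norm.
have w_theta y : (w y <= w (theta * y)%R)%E.
  exact: (minval_integral_mul_ge v_val ws_val y f_monic f_int f_theta).
have dE : (m + (r + s) = d)%N by rewrite addnA.
have dn' : (d.-1 < n)%N by rewrite prednK.
have mono i j : (i <= j < n)%N -> (delta i <= delta j)%E.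
  exact: delta_mono v_val w_theta delta_max _ _.
have q_int j : q j \is a polyOver (valring v) by have [] := q_poly j.
have nu_le j : (nu j <= numax)%E by apply: le_bigmax.
have T_full : row_full T.
  have /eqP T_free : row_free T by apply: reduced_row_free w_norm Tq q_red.
  by rewrite /row_full T_free dE.
(* Both inequalities: an optimal monic polynomial is bounded by the family, and
   a member of maximal value is bounded by delta. *)
have delta_d : delta d.-1 = numax.
  apply/le_anti/andP; split.
    have [[p [po pm ps] ->] _] := delta_max _ dn'.
    apply: (reduced_norm_le v_val w_norm (i := d.-1) Tq q_int q_red T_full nu_le).
      by rewrite ps prednK // dE.
    have -> : p`_d.-1 = 1 by rewrite -(monicP pm) lead_coefE ps.
    by rewrite (val1 v_val).
  have [|j _|j _ numaxE] := @eq_bigmax _ _ _ -oo%E (Ordinal d_gt0) xpredT nu.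
  - by [].
  - exact: leNye.
  have [_ qs gj] := q_poly j; have [i qi] := gauss_eq0_nonmax gj.
  rewrite /numax numaxE.
  apply: (norm_le_delta v_val w_norm w_theta delta_max dn' (q_int j) qi).
  by rewrite prednK.
have g_ge i : (numax <= w (horner_alg theta (g i)))%E.
  exact: (norm_row_mx1C_ge w_norm Tq nu_top P_GL PT).
have T'_int := T'_int v_val Tq q_int P_GL PT.
have [h_red h_val] :=
  elimination_reduced v_val w_norm Tq q_int q_red nu_le nu_top P_GL PT.
have g_mon i : g i \is monic /\ size (g i) = (d - i)%N.
  by rewrite -dE; apply: monic_row_poly_row_mx1.
have g_delta i : (w (horner_alg theta (g i)) <= delta (d - i.+1)%N)%E.
  have [gm gs] := g_mon i.
  have i_lt : (d - i.+1 < n)%N by lia.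
  have [_ ub] := delta_max _ i_lt; apply: ub; split=> //.
    apply: (proj2 (mxOver_valring_row_poly v_val _)).
    exact: (row_mx1C_int v_val Tq q_int P_GL PT).
  rewrite gs; have := ltn_ord i; rewrite /d; lia.
have delta_low : (0 < r + s)%N -> (delta (r + s)%N.-1 < numax)%E.
  move=> rs0; have rsn : ((r + s).-1 < n)%N by lia.
  have [[p [po pm ps] ->] _] := delta_max _ rsn.
  apply: (@monic_norm_lt _ _ _ _ _ v_val w_norm _ T' (Ordinal rs0)) => //.
    move=> j; rewrite h_val; case: (split_ordP j) => {}j ->.
      left; split; first exact: nu_le.
      by rewrite col_mxEu; apply: D0.
    right; split; last exact/mxOver_valringP.
    by apply: nu_low => /=; rewrite /l addnA leq_addr.
  by rewrite ps prednK.
have D_max : D \is a mxOver (maxideal v).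
  apply/mxOverP => i j; have := ltn_ord i => ir.
  have rs0 : (0 < r + s)%N by lia.
  rewrite inE ltNge; apply/negP => Dij.
  have := delta_low rs0; rewrite ltNge => /negP; apply.
  have <- : w (horner_alg theta (h (lshift s i))) = numax.
    by rewrite h_val; apply: nu_top; rewrite /= /l ltn_add2l.
  apply: (norm_le_delta v_val w_norm w_theta delta_max (i := rev_ord j)).
  - by lia.
  - by apply: (proj2 (mxOver_valring_row_poly v_val _)).
  - by rewrite coef_row_poly col_mxEu.
  - by rewrite prednK // size_row_poly.
have delta_eq k : (k < d)%N -> (delta k == delta d.-1) = (r + s <= k)%N.
  move=> kd; have [rsk|krs] := leqP (r + s) k; last first.
    apply/lt_eqF/le_lt_trans; last by rewrite delta_d; apply: delta_low; lia.
    by apply: mono; lia.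
  (* The last row of (I C) has the smallest degree, r + s. *)
  have m0 : (m.-1 < m)%N by move: rsk kd; rewrite /d; lia.
  apply/eqP/le_anti; rewrite mono /=; last by lia.
  rewrite delta_d; apply: le_trans (g_ge (Ordinal m0)) _.
  by apply: le_trans (g_delta _) _; apply: mono; rewrite /= /d; lia.
have h0 j : h j != 0.
  apply/eqP => hj; have := proj1 h_red j.
  by rewrite -[row_poly _ _]/(h j) hj raddf0 eqxx.
have pi0 : pi != 0 by apply/eqP => p0; move: v_pi; rewrite p0 (val0 v_val).
split.
- split=> //.
    apply: (@count_mem_mkseq_block _ _ _ (r + s)); first by rewrite /d; lia.
    by move=> k kd; rewrite delta_eq //; move: kd; rewrite /d; lia.
  move=> delta_gt; apply: (@count_mem_mkseq_block _ _ _ (r + s)); first by lia.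
  move=> k kn; have [kd|dk] := ltnP k d.
    by rewrite delta_eq //; move: kd; rewrite /d; lia.
  have := delta_gt (leq_ltn_trans dk kn) => delta_gt'.
  rewrite gt_eqF; first by move: dk; rewrite /d; lia.
  by apply: lt_le_trans delta_gt' _; apply: mono; rewrite dk.
- move=> i; have [gm gs] := g_mon i; split=> //.
  apply/le_anti; rewrite delta_d g_ge andbT -delta_d.
  apply: le_trans (g_delta _) _; apply: mono; lia.
- exact: D_max.
have c0 j : pi ^ (- fine (gauss v (h j))) != 0 by rewrite expfz_neq0.
have gauss_q' j : gauss v (q' j) = 0%E.
  rewrite /q' gaussZ // (discrete_val_expz _ v_val v_pi).
  by rewrite EFinN fineK ?gauss_fin // addeC subee ?gauss_fin.
have q'E j : horner_alg theta (q' j) =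
    pi ^ (- fine (gauss v (h j))) *: horner_alg theta (h j) by exact: horner_algZ.
split; first split.
- move=> j; split=> //.
    by apply/(polyOver_valringP _ v_val) => i; rewrite -(gauss_q' j) gauss_le.
  by rewrite /q' size_scale // size_row_poly.
- exact: (reduced_scale w_norm c0 q'E h_red).
move=> j; rewrite q'E (normZ w_norm) (discrete_val_expz _ v_val v_pi) h_val.
by rewrite EFinN fineK ?gauss_fin // int_ratN addeC.
Qed.
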